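(* For every $\epsilon>0$ there exist infinitely many positive integers $N$ such that \[ \gcd(N,\sigma(N))\ge N^{2/3-\epsilon}. \]
   Context: $\sigma(N)$ denotes the sum of the positive divisors of $N$. *)

(* Defs.v *)
From HB Require Import structures.
From mathcomp Require Import all_boot all_order all_algebra.

Set Implicit Arguments.
Unset Strict Implicit.
Unset Printing Implicit Defensive.

(* [divisors 0] is [:: 1], so [sigma 0 = 1]; only positive arguments are
   meaningful. *)
Definition sigma (n : nat) : nat := \sum_(d <- divisors n) d.

(* Main.v *)
(* If B is an integer for which p, B and sigma(B) are pairwise coprime and B
   divides p + 1 = sigma(p), then N = p B sigma(B) has
   sigma(N) = (p + 1) sigma(B) sigma(sigma(B)), so B sigma(B) divides
   gcd(N, sigma(N)). As sigma(B) >= B, this gcd is at least N^(2/3 - o(1)) as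
   soon as B = p^(1 - o(1)).
   For B we take the part of p + 1 composed of the primes > W = (log x)^4, where
   p <= x. Since primes have density at least of order 1 / log x (Chebyshev, by
   the central binomial coefficient), it is enough to discard sets of integers
   n <= x of size O(x / (log x)^3) and find a p such that n = p + 1 survives:
   - n with more than W divisors; otherwise n has O(log log x) prime factors;
   - n divisible by d^2 for some d > W; otherwise B is squarefree, and each prime
     power dividing n / B is at most W^3, so n / B = x^(o(1));
   - n divisible by r s with r > W and r | s + 1; otherwise B and sigma(B), which
     is the product of the s + 1, are coprime. *)
Require Import Defs.
From HB Require Import structures.
From mathcomp Require Import all_boot all_order all_algebra.
From mathcomp Require Import all_classical all_reals all_analysis.
From mathcomp Require Import zify ring lra.

Set Implicit Arguments.
Unset Strict Implicit.
Unset Printing Implicit Defensive.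

Import Order.TTheory GRing.Theory Num.Theory.
Import numFieldNormedType.Exports.

Local Open Scope nat_scope.

(** * Multiplicativity of sigma and of the number of divisors *)

Lemma perm_divisorsM a b : 0 < a -> 0 < b -> coprime a b ->
  perm_eq (divisors (a * b)) [seq d * e | d <- divisors a, e <- divisors b].
Proof.
move=> a0 b0 cab.
(* A pair of divisors is recovered from its product by taking gcds with [a] and [b]; hence
   injectivity, and the same map supplies the preimage for surjectivity. *)
have gcdK d e : d %| a -> e %| b -> gcdn (d * e) a = d /\ gcdn (d * e) b = e.
  move=> da eb; split.
    rewrite gcdnC Gauss_gcdl; first exact/gcdn_idPr.
    exact: coprime_dvdr eb cab.
  rewrite gcdnC mulnC Gauss_gcdl; first exact/gcdn_idPr.
  by rewrite coprime_sym; exact: coprime_dvdl da cab.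
apply: uniq_perm; first exact: divisors_uniq.
  apply: allpairs_uniq; try exact: divisors_uniq.
  move=> _ _ /allpairsP[[d e]/= [da eb ->]] /allpairsP[[d' e']/= [da' eb' ->]].
  rewrite -!dvdn_divisors // in da eb da' eb'.
  move=> /= E; have [h1 h2] := gcdK _ _ da eb.
  by have [h3 h4] := gcdK _ _ da' eb'; congr (_, _); [rewrite -h1 -h3 E | rewrite -h2 -h4 E].
move=> x; rewrite -dvdn_divisors ?muln_gt0 ?a0 //.
apply/idP/allpairsP => [xab|[[d e]/= [da eb ->]]].
  exists (gcdn x a, gcdn x b) => /=; rewrite -!dvdn_divisors ?dvdn_gcdr //.
  split=> //; apply/eqP; rewrite eqn_dvd Gauss_dvd ?dvdn_gcdl ?andbT; last first.
    by apply: coprime_dvdl (dvdn_gcdr _ _) (coprime_dvdr (dvdn_gcdr _ _) cab).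
  by rewrite muln_gcdl !muln_gcdr !dvdn_gcd xab !(dvdn_mulr _ (dvdnn x)) ?dvdn_mull.
by apply: dvdn_mul; rewrite dvdn_divisors.
Qed.

Lemma sigmaM a b : 0 < a -> 0 < b -> coprime a b ->
  sigma (a * b) = sigma a * sigma b.
Proof.
move=> a0 b0 cab; rewrite /sigma (perm_big _ (perm_divisorsM a0 b0 cab)) /=.
rewrite big_allpairs_dep big_distrl /=; apply: eq_bigr => d _.
by rewrite big_distrr.
Qed.

Lemma size_divisorsM a b : 0 < a -> 0 < b -> coprime a b ->
  size (divisors (a * b)) = size (divisors a) * size (divisors b).
Proof.
by move=> a0 b0 cab; rewrite (perm_size (perm_divisorsM a0 b0 cab)) size_allpairs.
Qed.

Lemma prod_primesE n : 0 < n -> n = \prod_(p <- primes n) p ^ logn p n.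
Proof. by move=> n0; rewrite {1}(prod_prime_decomp n0) prime_decompE big_map. Qed.

Lemma multiplicative_prod (f : nat -> nat) : f 1 = 1 ->
    (forall a b, 0 < a -> 0 < b -> coprime a b -> f (a * b) = f a * f b) ->
  forall n, 0 < n -> f n = \prod_(p <- primes n) f (p ^ logn p n).
Proof.
move=> f1 fM n n0; rewrite {1}(prod_primesE n0).
have := primes_uniq n.
have: all prime (primes n) by exact: all_prime_primes.
elim: (primes n) => [|p s IHs]; first by rewrite !big_nil.
case/andP=> p_pr s_pr /andP[ps us]; rewrite !big_cons.
have gt0 q : prime q -> 0 < q ^ logn q n by move=> q_pr; rewrite expn_gt0 prime_gt0.
rewrite fM ?IHs ?gt0 //.
  rewrite big_seq; apply: prodn_cond_gt0 => q qs.
  by rewrite gt0 // (allP s_pr).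
rewrite big_seq; apply: (big_ind (coprime _)) => [|x y|q qs].
- by rewrite coprimen1.
- by rewrite coprimeMr => -> ->.
have q_pr : prime q by exact: (allP s_pr).
apply/coprimeXl/coprimeXr; rewrite prime_coprime // dvdn_prime2 //.
by apply: contraNneq ps => ->.
Qed.

Lemma sigma1 : sigma 1 = 1.
Proof. by rewrite /sigma (_ : divisors 1 = [:: 1]) // big_seq1. Qed.

Lemma sigma_prime p : prime p -> sigma p = p.+1.
Proof.
move=> p_pr; have p1 := prime_gt1 p_pr.
suff E : perm_eq (divisors p) [:: 1; p].
  by rewrite /sigma (perm_big _ E) /= !big_cons big_nil addn0 add1n.
apply: uniq_perm; rewrite ?divisors_uniq //=.
  by rewrite inE andbT neq_ltn p1.
move=> d; rewrite -dvdn_divisors ?prime_gt0 // !inE.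
apply/idP/idP => [|/orP[]/eqP-> //].
by have [_ /(_ d) H] := primeP p_pr => /H.
Qed.

Lemma leq_sigma n : 0 < n -> n <= sigma n.
Proof.
by move=> n0; rewrite /sigma (big_rem n) ?divisors_id //= leq_addr.
Qed.

Lemma sigma_squarefree n : 0 < n -> (forall p, prime p -> ~~ (p ^ 2 %| n)) ->
  sigma n = \prod_(p <- primes n) p.+1.
Proof.
move=> n0 sqf; rewrite (multiplicative_prod sigma1 sigmaM n0).
rewrite big_seq [RHS]big_seq; apply: eq_bigr => p pn.
have /and3P[p_pr _ _] : [&& prime p, 0 < n & p %| n] by rewrite -mem_primes.
have := sqf p p_pr; rewrite pfactor_dvdn // -leqNgt => pn1.
have -> : logn p n = 1 by apply/eqP; rewrite eqn_leq pn1 logn_gt0.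
by rewrite expn1 sigma_prime.
Qed.

(** Each exact prime power in [n] has at least two divisors, 1 and itself. A bound on the number of
    divisors thus gives a logarithmic bound on the number of primes. *)
Lemma exp2_omega_le n : 0 < n -> 2 ^ size (primes n) <= size (divisors n).
Proof.
move=> n0.
rewrite (multiplicative_prod (f := fun n => size (divisors n)) erefl size_divisorsM n0).
rewrite -sum1_size expn_sum.
rewrite big_seq [leqRHS]big_seq; apply: leq_prod => p.
rewrite mem_primes => pn; have [p_pr _ _] := and3P pn; rewrite -mem_primes in pn.
rewrite expn1; have -> : 2 = size [:: 1; p ^ logn p n] by [].
have p1 : 1 < p ^ logn p n by rewrite -(exp1n (logn p n)) ltn_exp2r ?prime_gt1 ?logn_gt0.
apply: uniq_leq_size; first by rewrite /= inE andbT neq_ltn p1.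
move=> d; rewrite !inE => /orP[]/eqP->; first exact: divisor1.
by apply: divisors_id; apply: ltnW.
Qed.

(** * The parts of p + 1 below and above W *)

(** Let [q ^ v] be a prime power of the small part. The square of [q ^ v./2] divides [n], so
    [q ^ v./2 <= W]; at most one more factor [q <= W] remains, whence [q ^ v <= W ^ 3]. *)
Lemma smooth_part_le n W : 0 < n -> 0 < W -> (forall d, W < d -> ~~ (d ^ 2 %| n)) ->
  n`_[pred q | q <= W] <= W ^ (3 * size (primes n)).
Proof.
move=> n0 W0 sq.
rewrite (prod_primesE (part_gt0 _ _)) primes_part big_filter.
rewrite expnM -sum1_size expn_sum.
rewrite big_mkcond big_seq [leqRHS]big_seq; apply: leq_prod => q.
rewrite expn1; case: ifP => [qW|_]; last by rewrite expn_gt0 W0.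
rewrite mem_primes => /and3P[q_pr _ _].
set v := logn q _.
have vn : q ^ v %| n by apply: dvdn_trans (pfactor_dvdnn _ _) (dvdn_part _ _).
have hW : q ^ v./2 <= W.
  rewrite leqNgt; apply/negP => /sq/negP; apply; apply: dvdn_trans vn.
  by rewrite -expnM dvdn_exp2l // muln2 -[leqRHS](odd_double_half v) leq_addl.
rewrite -[v in leqLHS](odd_double_half v) expnD -muln2 expnM.
rewrite [W ^ 3]expnS leq_mul ?leq_sqr //.
by case: (odd v) => //; exact: qW.
Qed.

Lemma dvdn_gcd_sigma p B : prime p -> B %| p.+1 ->
    coprime B (sigma B) -> coprime p (sigma B) ->
  B * sigma B %| gcdn (p * B * sigma B) (sigma (p * B * sigma B)).
Proof.
move=> p_pr Bp cB cp.
have p0 := prime_gt0 p_pr; have B0 : 0 < B := dvdn_gt0 (ltn0Sn p) Bp.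
have s0 : 0 < sigma B by apply: leq_trans B0 (leq_sigma B0).
have cpB : coprime p B by apply: coprime_dvdr Bp (coprimenS p).
rewrite dvdn_gcd -mulnA dvdn_mull //= !sigmaM ?muln_gt0 ?B0 //.
  by apply: dvdn_mul; [rewrite sigma_prime | exact: dvdn_mulr].
by rewrite coprimeMr cpB cp.
Qed.

Lemma primes_dvd_sigma_squarefree n r : 0 < n -> (forall p, prime p -> ~~ (p ^ 2 %| n)) ->
  prime r -> r %| sigma n -> exists s, [/\ prime s, s %| n & r %| s.+1].
Proof.
move=> n0 sqf r_pr; rewrite (sigma_squarefree n0 sqf) Euclid_dvd_prod //.
rewrite big_tnth; rewrite big_orE => /existsP[i /= h].
have := mem_tnth i (in_tuple (primes n)); rewrite mem_primes => /and3P[s_pr _ sn].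
by exists (tnth (in_tuple (primes n)) i).
Qed.

(* The last clause with [s] prime says that no prime factor [r > W] of [n]
   divides [sigma s] for another prime factor [s]. *)
Definition admissible W n := [/\ size (divisors n) <= W,
  forall d, W < d -> ~~ (d ^ 2 %| n) &
  forall r s, W < r -> 0 < s -> r %| s.+1 -> ~~ (r * s %| n)].

(** The primes of [B] exceed [W], so [B] is squarefree and a prime dividing [sigma B] divides [s.+1]
    for some prime [s %| B]. If such a prime [r] also divides [B], then [r * s] divides [p.+1],
    against the third clause of admissibility. *)
Lemma rough_part_sigma p W : prime p -> 3 < p -> admissible W p.+1 ->
  let B := p.+1`_[pred q | W < q] in coprime B (sigma B) /\ coprime p (sigma B).
Proof.
move=> p_pr p3 [_ sq rs] B.
have B0 : 0 < B by exact: part_gt0.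
have BW q : prime q -> q %| B -> W < q.
  by move=> q_pr qB; have := mem_primes q B; rewrite primes_part mem_filter q_pr qB B0 => /andP[].
have Bp : B %| p.+1 by exact: dvdn_part.
have sqf q : prime q -> ~~ (q ^ 2 %| B).
  move=> q_pr; apply/negP => qB; have qW := BW _ q_pr (dvdn_trans (dvdn_exp _ (dvdnn q)) qB).
  by apply: (negP (sq q (qW isT))); exact: dvdn_trans qB Bp.
split.
  rewrite coprime_has_primes // ?(leq_trans B0) ?leq_sigma //; apply/hasPn => r.
  rewrite mem_primes => /and3P[r_pr _ /(primes_dvd_sigma_squarefree B0 sqf r_pr)[s [s_pr sB rs1]]].
  rewrite mem_primes r_pr B0 /=; apply/negP => rB.
  apply: (negP (rs r s (BW _ r_pr rB) (prime_gt0 s_pr) rs1)).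
  apply: dvdn_trans Bp; rewrite Gauss_dvd ?rB //.
  (* If [r = s], then [r] divides both [s] and [s.+1], hence 1. *)
  rewrite prime_coprime // dvdn_prime2 //; apply/eqP => ers.
  by move: rs1; rewrite -ers -addn1 dvdn_addr ?dvdnn // dvdn1 => /eqP r1; rewrite r1 in r_pr.
rewrite prime_coprime //; apply/negP => /(primes_dvd_sigma_squarefree B0 sqf p_pr)[s [s_pr sB ps]].
have sp := dvdn_trans sB Bp.
(* If the cofactor of [s] in [p.+1] is 1, then [p] and [p.+1] are both prime, impossible for
   [p > 3]. If it is at least 2, then s + 1 <= (p + 3) / 2 < p, so [p] cannot divide [s.+1]. *)
have spE := divnK sp; have := dvdn_leq (ltn0Sn s) ps.
case: (p.+1 %/ s) spE => [|[|c]] spE; first by lia.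
  have p2 : odd p by case: (even_prime p_pr) => // p2; lia.
  move: spE; rewrite mul1n => es; rewrite es in s_pr.
  by case: (even_prime s_pr) => [|/=]; [lia | rewrite p2].
have s2 : 2 * s <= p.+1 by rewrite -spE leq_mul2r orbT.
by lia.
Qed.

(** * Chebyshev's lower bound for the number of primes *)

Lemma prod_leq_exp_size (s : seq nat) (f : nat -> nat) M :
  (forall q, q \in s -> f q <= M) -> \prod_(q <- s) f q <= M ^ size s.
Proof.
move=> h; rewrite -sum1_size expn_sum big_seq [leqRHS]big_seq.
by apply: leq_prod => q /h; rewrite expn1.
Qed.

(** By Legendre's formula the exponent is the sum over k of floor(2m / p^k) - 2 floor(m / p^k). Each
    term is 0 or 1, and it vanishes once p^k > 2m. *)
Lemma pfactor_central_bin p m : prime p -> 0 < m -> p ^ logn p 'C(m.*2, m) <= m.*2.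
Proof.
move=> p_pr m0; set v := logn _ _.
have m20 : 0 < m.*2 by rewrite double_gt0.
apply: leq_trans (trunc_logP (prime_gt1 p_pr) m20).
rewrite leq_exp2l ?prime_gt1 //.
have mm : m <= m.*2 by rewrite -addnn leq_addr.
have E : v + (logn p m`!).*2 = logn p (m.*2)`!.
  rewrite -(bin_fact mm) !lognM ?muln_gt0 ?fact_gt0 ?bin_gt0 //.
  have e : m.*2 - m = m by lia.
  by rewrite e addnn.
rewrite !logn_fact // in E.
(* The sum for [m]! is extended by zero terms, so that both sums have the same range. *)
have {}E : v + (\sum_(1 <= k < m.*2.+1) m %/ p ^ k).*2 = \sum_(1 <= k < m.*2.+1) m.*2 %/ p ^ k.
  rewrite -E; congr (_ + _.*2).
  rewrite (big_cat_nat (n := m.+1)) //= [X in _ + X]big_nat_cond [X in _ + X]big1 ?addn0 //.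
  move=> i /andP[/andP[mi _] _]; apply: divn_small; apply: leq_trans mi _.
  by apply/ltnW/ltn_expl/prime_gt1.
have : \sum_(1 <= k < m.*2.+1) m.*2 %/ p ^ k <=
   \sum_(1 <= k < m.*2.+1) ((m %/ p ^ k).*2 + (k <= trunc_log p m.*2)).
  apply: leq_sum => k _.
  have pk : 0 < p ^ k by rewrite expn_gt0 prime_gt0.
  case: (leqP k) => hk.
    by rewrite addn1 -ltnS ltn_divLR // -doubleS -doubleMl ltn_double ltn_ceil.
  by rewrite divn_small // (leq_trans (trunc_log_ltn _ (prime_gt1 p_pr))) // leq_exp2l ?prime_gt1.
have dbl : \sum_(1 <= k < m.*2.+1) (m %/ p ^ k).*2 = (\sum_(1 <= k < m.*2.+1) m %/ p ^ k).*2.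
  by rewrite -[RHS]muln2 big_distrl /=; apply: eq_bigr => k _; rewrite muln2.
rewrite big_split /= dbl -E addnC leq_add2l => /leq_trans; apply.
elim: (m.*2) (trunc_log p _) => [|n IHn] t; first by rewrite big_geq.
rewrite big_nat_recr //=; case: (leqP n.+1 t) => [nt|_]; last by rewrite addn0 IHn.
apply: (@leq_trans (\sum_(1 <= k < n.+1) 1 + 1)).
  by rewrite leq_add2r; apply: leq_sum => k _; case: (k <= t).
by rewrite sum_nat_const_nat; lia.
Qed.

Lemma exp2_le_central_bin m : 2 ^ m <= 'C(m.*2, m).
Proof.
elim: m => // m IHm.
have h : 'C(m.*2.+1, m) = 'C(m.*2.+1, m.+1).
  rewrite -[RHS]bin_sub ?ltnS -?addnn ?leq_addr //; congr 'C(_, _).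
  by rewrite subSS addnK.
rewrite doubleS binS h addnn expnS mul2n leq_double binS.
exact: leq_trans IHm (leq_addl _ _).
Qed.

(** With 2m = 2^k, the binomial coefficient is at least 2^m and is a product of prime powers at most
    2^k, one for each of its primes, all at most 2m. Comparing exponents of 2 gives m <= k times the
    number of primes. *)
Lemma prime_count_lower k : 1 < k ->
  2 ^ k <= 2 * k * \sum_(1 <= p < 2 ^ k) prime p.
Proof.
move=> k1.
pose m := 2 ^ k.-1.
have m2 : m.*2 = 2 ^ k by rewrite -mul2n -expnS prednK // ltnW.
have m0 : 0 < m by rewrite expn_gt0.
have b0 : 0 < 'C(m.*2, m) by rewrite bin_gt0 -addnn leq_addr.
have h : 2 ^ m <= (2 ^ k) ^ size (primes 'C(m.*2, m)).
  apply: leq_trans (exp2_le_central_bin m) _.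
  rewrite [leqLHS](prod_primesE b0) -m2; apply: prod_leq_exp_size => q.
  by rewrite mem_primes => /andP[q_pr _]; apply: pfactor_central_bin.
rewrite -expnM leq_exp2l // in h.
rewrite -{1}m2 -mul2n -mulnA leq_pmul2l //; apply: leq_trans h _.
rewrite leq_mul2l; apply/orP; right.
rewrite -big_mkcond /= -[X in _ <= X]big_filter -[size _]/(size _) sum1_size.
apply: uniq_leq_size; first exact: primes_uniq.
move=> q; rewrite mem_primes => /and3P[q_pr _ qb].
rewrite mem_filter q_pr mem_index_iota prime_gt0 //=.
have : q <= 2 ^ k.
  rewrite -m2; apply: leq_trans (pfactor_central_bin q_pr m0).
  rewrite -[leqLHS]expn1 leq_exp2l ?prime_gt1 // logn_gt0 mem_primes q_pr b0 //.
(* The endpoint 2^k falls outside the range of the sum; it is not prime because [k > 1]. *)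
rewrite leq_eqVlt => /orP[/eqP qk|//].
move: q_pr; rewrite qk => q_pr.
have := dvdn_prime2 (isT : prime 2) q_pr.
by rewrite dvdn_exp ?(ltnW k1) // -[X in X == _](expn1 2) eqn_exp2l // => /esym/eqP k1'; rewrite -k1' in k1.
Qed.

(** * Reciprocal sums and counts of multiples *)

(** Telescoping: 1 / d^2 <= 1 / (d - 1) - 1 / d. *)
Lemma sum_inv_sqr_le W m : 0 < W ->
  (\sum_(W.+1 <= d < (W + m).+1) (d%:R ^- 2) <= W%:R^-1 - (W + m)%:R^-1 :> rat)%R.
Proof.
move=> W0; elim: m => [|m IHm]; first by rewrite addn0 big_geq // subrr.
rewrite addnS big_nat_recr ?ltnS ?leq_addr //=.
have x0 : (0 < (W + m)%:R :> rat)%R by rewrite ltr0n ltn_addr.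
have -> : ((W + m).+1%:R = (W + m)%:R + 1 :> rat)%R by rewrite -natr1.
apply: le_trans (lerD IHm (lexx _)) _.
move: ((W + m)%:R)%R x0 => x x0.
rewrite -addrA lerD2l addrC -subr_ge0.
have -> : (- (x + 1)^-1 - ((x + 1) ^- 2 - x^-1) = x^-1 * (x + 1) ^- 2)%R.
  by field; rewrite !lt0r_neq0 ?addr_gt0.
by rewrite mulr_ge0 // invr_ge0 ?exprn_ge0 ?ltW ?addr_gt0.
Qed.

(** The dyadic block from 2^k + 1 to 2^(k+1) has 2^k terms, each at most 2^(-k), so it adds at most
    1. *)
Lemma sum_inv_le k : (\sum_(1 <= d < (2 ^ k).+1) (d%:R^-1) <= k.+1%:R :> rat)%R.
Proof.
elim: k => [|k IHk]; first by rewrite expn0 big_nat1 invr1.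
rewrite (big_cat_nat (n := (2 ^ k).+1)) //=; last by rewrite ltnS leq_exp2l.
rewrite -[leRHS]natr1 lerD //.
apply: (@le_trans _ _ (\sum_((2 ^ k).+1 <= d < (2 ^ k.+1).+1) (2 ^ k)%:R^-1)%R).
  rewrite big_nat [leRHS]big_nat; apply: ler_sum => d /andP[kd _].
  by rewrite lef_pV2 ?posrE ?ltr0n ?expn_gt0 ?(leq_ltn_trans _ kd) // ler_nat ltnW.
rewrite sumr_const_nat subSS expnS mul2n -addnn addnK.
by rewrite -[leLHS]mulr_natl divff // pnatr_eq0 expn_eq0.
Qed.

Lemma ler_divn X m : ((X %/ m)%:R <= X%:R / m%:R :> rat)%R.
Proof.
case: m => [|m]; first by rewrite divn0 invr0 mulr0.
by rewrite ler_pdivlMr ?ltr0n // -natrM ler_nat leq_divM.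
Qed.

Lemma sum_divn_le k : \sum_(1 <= d < (2 ^ k).+1) 2 ^ k %/ d <= k.+1 * 2 ^ k.
Proof.
rewrite -(ler_nat rat) natr_sum natrM mulrC.
apply: le_trans (ler_wpM2l _ (sum_inv_le k)); last exact: ler0n.
by rewrite mulr_sumr; apply: ler_sum => d _; exact: ler_divn.
Qed.

Lemma sum_divn_sqr_le W X : 0 < W -> W * (\sum_(W.+1 <= d < X.+1) X %/ d ^ 2) <= X.
Proof.
move=> W0; case: (leqP X W) => [XW|/ltnW/subnKC <-]; first by rewrite big_geq ?muln0.
set m := X - W; rewrite -(ler_nat rat) natrM natr_sum.
have W0' : (0 < W%:R :> rat)%R by rewrite ltr0n.
rewrite mulrC -ler_pdivlMr //.
have h := sum_inv_sqr_le m W0.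
have h' : (\sum_(W.+1 <= d < (W + m).+1) (d%:R ^- 2) <= W%:R^-1 :> rat)%R.
  by apply: le_trans h _; rewrite lerBlDr lerDl invr_ge0.
apply: le_trans (ler_wpM2l (ler0n _ _) h').
by rewrite mulr_sumr; apply: ler_sum => d _; rewrite -natrX; exact: ler_divn.
Qed.

(** Pairs with [r %| s.+1] are parametrised by [s = (r * t).-1]. Since r t >= 2, r t - 1 >= r t / 2,
    so each term is at most 2 X / (r^2 t). The sum over [r] then contributes 1 / W and the sum over
    [t] at most k + 1. *)
Lemma sum_divn_pairs_le W k : 0 < W ->
  W * (\sum_(W.+1 <= r < (2 ^ k).+1) \sum_(1 <= t < (2 ^ k).+1) 2 ^ k %/ (r * (r * t).-1))
    <= 2 * k.+1 * 2 ^ k.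
Proof.
move=> W0; set X := 2 ^ k.
case: (leqP X W) => [XW|/ltnW/subnKC EX]; first by rewrite big_geq ?muln0.
have W0' : (0 < W%:R :> rat)%R by rewrite ltr0n.
have h' : (\sum_(W.+1 <= d < X.+1) (d%:R ^- 2) <= W%:R^-1 :> rat)%R.
  rewrite -EX; apply: le_trans (sum_inv_sqr_le (X - W) W0) _.
  by rewrite lerBlDr lerDl invr_ge0.
rewrite -(ler_nat rat) natrM natr_sum mulrC -ler_pdivlMr //.
apply: (@le_trans _ _ (\sum_(W.+1 <= r < X.+1) \sum_(1 <= t < X.+1) (X%:R * 2 * (r%:R ^- 2 * t%:R^-1)))%R).
  rewrite big_nat [leRHS]big_nat; apply: ler_sum => r /andP[Wr _].
  rewrite natr_sum big_nat [leRHS]big_nat; apply: ler_sum => t /andP[t0 _].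
  apply: le_trans (ler_divn _ _) _; rewrite -mulrA ler_wpM2l //.
  have r1 : 1 < r by apply: leq_trans Wr.
  have -> : (2 * (r%:R ^- 2 * t%:R^-1) = (r%:R * (r%:R * t%:R / 2))^-1 :> rat)%R.
    by field; rewrite !pnatr_eq0; lia.
  have rt : 1 < r * t by rewrite (leq_trans r1) // leq_pmulr.
  rewrite lef_pV2 ?posrE ?natrM; last first.
  - by rewrite !mulr_gt0 ?invr_gt0 ?ltr0n //; lia.
  - by rewrite mulr_gt0 ?ltr0n //; lia.
  rewrite ler_wpM2l // ler_pdivrMr // -!natrM ler_nat; lia.
under eq_bigr do rewrite -mulr_sumr -mulr_sumr.
rewrite -mulr_sumr -mulr_suml.
have := ler_pM _ _ h' (sum_inv_le k); rewrite -/X => /(_ _ _) h2.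
apply: (@le_trans _ _ (X%:R * 2 * (W%:R^-1 * k.+1%:R))%R).
  rewrite ler_wpM2l ?mulr_ge0 // h2 //; apply: sumr_ge0 => i _;
  by rewrite invr_ge0 ?exprn_ge0.
by rewrite !natrM le_eqVlt; apply/orP; left; apply/eqP; field; rewrite lt0r_neq0.
Qed.

(** * Counting inadmissible integers *)

Lemma leq_sum_seq1 (I : eqType) (s : seq I) (F : I -> nat) i :
  i \in s -> F i <= \sum_(j <- s) F j.
Proof. by move=> is_; rewrite (big_rem i) //= leq_addr. Qed.

Lemma size_divisorsE X n : 0 < n <= X -> size (divisors n) = \sum_(1 <= d < X.+1) (d %| n).
Proof.
move=> /andP[n0 nX]; rewrite -big_mkcond -big_filter sum1_size; apply/perm_size/uniq_perm.
- exact: divisors_uniq.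
- exact/filter_uniq/iota_uniq.
move=> d; rewrite -dvdn_divisors // mem_filter mem_index_iota ltnS.
case: (boolP (d %| n)) => //= dn.
by rewrite (dvdn_gt0 n0 dn) (leq_trans (dvdn_leq n0 dn)).
Qed.

(* Union bound in weighted form: the sum of the right-hand side over [n <= X]
   bounds [W] times the number of inadmissible [n]. *)
Lemma not_admissible_weight W X n : 0 < W -> 0 < n <= X -> ~ admissible W n ->
  W <= \sum_(1 <= d < X.+1) (d %| n)
     + W * (\sum_(W.+1 <= d < X.+1) (d ^ 2 %| n))
     + W * (\sum_(W.+1 <= r < X.+1) \sum_(1 <= t < X.+1) (r * (r * t).-1 %| n)).
Proof.
move=> W0 nX bad; have /andP[n0 nX'] := nX.
rewrite -(size_divisorsE nX) leqNgt; apply/negP => h; apply: bad.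
have lt1 x y : y + W * x < W -> x = 0 by case: x => //; nia.
split; first by apply: ltnW; apply: leq_ltn_trans h; rewrite -addnA leq_addr.
- move=> d Wd; apply/negP => dn.
  suff : 0 < \sum_(W.+1 <= d < X.+1) (d ^ 2 %| n) by move: h; nia.
  have dX : d < X.+1.
    by have := dvdn_leq n0 dn; rewrite -mulnn; nia.
  have := @leq_sum_seq1 _ (index_iota W.+1 X.+1) (fun d => (d ^ 2 %| n) : nat) d.
  by rewrite mem_index_iota Wd dX /= dn; apply.
move=> r s Wr s0 rs; apply/negP => rsn.
suff : 0 < \sum_(W.+1 <= r < X.+1) \sum_(1 <= t < X.+1) (r * (r * t).-1 %| n).
  by move: h; nia.
(* The bad pair is counted at (r, t) with t = (s + 1) / r. Both [r] and [s] divide [n], hence are at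
   most [X], and [t <= s] because [r >= 2]. *)
have es := divnK rs; set t := s.+1 %/ r in es.
have rX : r < X.+1.
  by rewrite ltnS (leq_trans _ nX') // dvdn_leq // (dvdn_trans _ rsn) // dvdn_mulr.
have sX : s <= X by rewrite (leq_trans _ nX') // dvdn_leq // (dvdn_trans _ rsn) // dvdn_mull.
have t0 : 0 < t by case: (t) es.
have tX : t < X.+1 by rewrite ltnS (leq_trans _ sX) //; nia.
have := @leq_sum_seq1 _ (index_iota W.+1 X.+1) (fun r => \sum_(1 <= t < X.+1) (r * (r * t).-1 %| n) : nat) r.
rewrite mem_index_iota Wr rX => /(_ isT); apply: leq_trans.
have := @leq_sum_seq1 _ (index_iota 1 X.+1) (fun t => (r * (r * t).-1 %| n) : nat) t.
by rewrite mem_index_iota t0 tX [r * t]mulnC es /= rsn; apply.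
Qed.

Lemma sum_dvdn (I : Type) (s : seq I) (F : I -> nat) X :
  \sum_(1 <= n < X.+1) \sum_(i <- s) (F i %| n) = \sum_(i <- s) X %/ F i.
Proof. by rewrite exchange_big; apply: eq_bigr => i _; rewrite divn_count_dvd. Qed.

(** Summed over [n], each divisibility indicator counts multiples. The three parts give k + 1, 1 and
    2 (k + 1) times 2^k. *)
Lemma sum_not_admissible_weight_le W k : 0 < W ->
  \sum_(1 <= n < (2 ^ k).+1) (\sum_(1 <= d < (2 ^ k).+1) (d %| n)
     + W * (\sum_(W.+1 <= d < (2 ^ k).+1) (d ^ 2 %| n))
     + W * (\sum_(W.+1 <= r < (2 ^ k).+1) \sum_(1 <= t < (2 ^ k).+1) (r * (r * t).-1 %| n)))
  <= (3 * k + 4) * 2 ^ k.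
Proof.
move=> W0; rewrite !big_split /= -!big_distrr /= !sum_dvdn.
rewrite [X in _ + W * X]exchange_big /=.
under [X in _ + W * X]eq_bigr do rewrite sum_dvdn.
have := sum_divn_le k; have := sum_divn_sqr_le (2 ^ k) W0; have := sum_divn_pairs_le k W0.
by lia.
Qed.

(** * An admissible shifted prime and the resulting gcd *)

(** If there were none, every prime from sqrt X up to X would give an inadmissible p + 1, so W times
    the number of primes below X would be at most W sqrt X + (3k + 4) X. This contradicts
    Chebyshev's bound. *)
Lemma exists_admissible_prime j : 3 < j -> exists p,
  [/\ prime p, 2 ^ (2 ^ j.-1) <= p < 2 ^ (2 ^ j) & admissible (2 ^ (4 * j)) p.+1].
Proof.
move=> j3.
(* Thus k = log2 X, W = k^4 and 2^h = sqrt X. *)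
set h := 2 ^ j.-1; set k := 2 ^ j; set W := 2 ^ (4 * j); set X := 2 ^ k.
have W0 : 0 < W by rewrite expn_gt0.
have kE : k = 2 * h by rewrite /k /h -expnS prednK //; lia.
have WE : W = k ^ 4 by rewrite /W /k -expnM mulnC.
have XE : X = 2 ^ h * 2 ^ h by rewrite /X kE -expnD addnn mul2n.
have k16 : 16 <= k by rewrite (@leq_exp2l 2 4).
have hk : 4 * k <= 2 ^ h.
  rewrite /k -[4]/(2 ^ 2) -expnD leq_exp2l // /h.
  case: j j3 {h k W X W0 kE WE XE k16} => // j; rewrite ltnS /=.
  elim: j => // j IHj; rewrite leq_eqVlt => /orP[/eqP <- //|/IHj].
  by rewrite expnS; lia.
apply: contrapT => none.
pose f n := \sum_(1 <= d < X.+1) (d %| n)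
     + W * (\sum_(W.+1 <= d < X.+1) (d ^ 2 %| n))
     + W * (\sum_(W.+1 <= r < X.+1) \sum_(1 <= t < X.+1) (r * (r * t).-1 %| n)).
have step p : 1 <= p < X -> W * prime p <= W * (p < 2 ^ h) + f p.+1.
  move=> /andP[p0 pX]; case: (boolP (prime p)) => [p_pr|_]; last by rewrite muln0.
  case: (ltnP p (2 ^ h)) => [_|hp]; first by rewrite muln1 leq_addr.
  rewrite muln1 muln0; apply: not_admissible_weight => //.
  by move=> adm; apply: none; exists p; split=> //; apply/andP; split.
have small : \sum_(1 <= p < X) (p < 2 ^ h) <= 2 ^ h.
  rewrite -big_mkcond -big_filter sum1_size -[leqRHS](size_iota 0).
  apply: uniq_leq_size; first exact/filter_uniq/iota_uniq.
  by move=> p; rewrite mem_filter mem_iota => /andP[].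
have weights : \sum_(1 <= p < X) f p.+1 <= (3 * k + 4) * X.
  (* The shifted values p + 1 run from 2 to X, so only the term n = 1 is dropped. *)
  apply: leq_trans (sum_not_admissible_weight_le k W0); rewrite -/X -/f.
  rewrite -(@big_add1 _ 0 addn 1 X.+1 xpredT f).
  by rewrite [leqRHS]big_ltn ?leq_addl // ltnS expn_gt0.
have := prime_count_lower (leq_trans (isT : 1 < 16) k16); rewrite -/X.
set P := \sum_(_ <= _ < _) _ => chebyshev.
have : W * P <= W * 2 ^ h + (3 * k + 4) * X.
  rewrite /P big_distrr /=.
  apply: (@leq_trans (\sum_(1 <= p < X) (W * (p < 2 ^ h) + f p.+1))).
    by rewrite big_nat [leqRHS]big_nat; apply: leq_sum => p; exact: step.
  by rewrite big_split /= -big_distrr /= leq_add // leq_mul2l small orbT.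
have X0 : 0 < 2 ^ h by rewrite expn_gt0.
move=> upper; suff : W * X < W * X by rewrite ltnn.
apply: leq_ltn_trans (_ : _ <= 2 * k * (W * P)) _; first by nia.
apply: leq_ltn_trans (_ : _ <= 2 * k * (W * 2 ^ h + (3 * k + 4) * X)) _.
  by rewrite leq_mul2l upper orbT.
rewrite XE; move: (2 ^ h) hk X0 => Y hk Y0.
rewrite WE mulnDr.
have -> : 2 * k * (k ^ 4 * Y) = 2 * k ^ 4 * (k * Y) by lia.
(* Both error terms are at most half of W X: the first because 4 k <= sqrt X, the second, strictly,
   because 4 k (3 k + 4) < k^4 for k >= 16. *)
have h1 : 2 * (2 * k ^ 4 * (k * Y)) <= k ^ 4 * (Y * Y) by nia.
have h2 : 2 * (2 * k * ((3 * k + 4) * (Y * Y))) < k ^ 4 * (Y * Y).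
  have kk : 16 * k <= k * k by rewrite leq_mul2r k16 orbT.
  have kk256 : 256 * (k * k) <= k ^ 4.
    by rewrite (_ : k ^ 4 = k * k * (k * k)) ?leq_mul2r ?(@leq_mul 16 16) ?orbT // !mulnn -expnM.
  have k4 : 4 * k * (3 * k + 4) < k ^ 4 by move: kk kk256; rewrite mulnDr; lia.
  by rewrite !mulnA -[ltnRHS]mulnA -mulnA ltn_pmul2r ?muln_gt0 ?Y0.
by lia.
Qed.

(** The small part of p + 1 is at most W^(3 w), where w <= log2 W = 4 j is its number of primes;
    this is the source of 48 j^2 = 4 j * 3 * 4 j. Since log2 p >= 2^(j-1), the loss is p^(o(1)). *)
Lemma exists_large_gcd j : 3 < j -> exists p B,
  [/\ prime p, 2 ^ (2 ^ j.-1) <= p, 0 < B, p <= B * 2 ^ (48 * j ^ 2) &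
      B * sigma B <= gcdn (p * B * sigma B) (sigma (p * B * sigma B))].
Proof.
move=> j3; have [p [p_pr /andP[hp _] adm]] := exists_admissible_prime j3.
set W := 2 ^ (4 * j) in adm.
have W0 : 0 < W by rewrite expn_gt0.
pose B := p.+1`_[pred q | W < q].
have B0 : 0 < B by exact: part_gt0.
have p3 : 3 < p.
  apply: leq_trans hp; rewrite (@leq_exp2l 2 2) // (@leq_exp2l 2 1) //; lia.
have [cB cp] := rough_part_sigma p_pr p3 adm.
exists p, B; split=> //; last first.
  apply: dvdn_leq (dvdn_gcd_sigma p_pr (dvdn_part _ _) cB cp).
  by rewrite gcdn_gt0 !muln_gt0 prime_gt0 // B0 (leq_trans B0) ?leq_sigma.
have [tau sq _] := adm.
have omega : size (primes p.+1) <= 4 * j.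
  by rewrite -(@leq_exp2l 2) // (leq_trans (exp2_omega_le _)).
have := smooth_part_le (ltn0Sn p) W0 sq.
rewrite -(@eq_partn [pred q | W < q]^'); last by move=> q; rewrite !inE -leqNgt.
move=> smooth; rewrite -ltnS -[X in X <= _](@partnC [pred q | W < q]) //.
apply: leqW; rewrite leq_mul2l; apply/orP; right; apply: leq_trans smooth _.
rewrite -expnM leq_exp2l // -mulnn.
have -> : 48 * (j * j) = 4 * j * (3 * (4 * j)) by lia.
by rewrite !leq_mul2l omega !orbT.
Qed.

(** * Passage to real exponents and conclusion *)

Lemma leq_cube_exp2 j : 9 < j -> j ^ 3 <= 2 ^ j.
Proof.
elim: j => // j IHj; rewrite ltnS leq_eqVlt => /orP[/eqP <- //|j9].
have := IHj j9; rewrite [2 ^ j.+1]expnS => h.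
apply: (@leq_trans (2 * j ^ 3)); last by rewrite leq_mul2l h.
rewrite !expnS expn0; nia.
Qed.

Local Open Scope classical_set_scope.
Local Open Scope ring_scope.

(** In logarithms the goal is (2/3 - eps) ln p <= (1/3 + eps) ln G. The bounds on [p] and [G] give
    ln G >= 2 (ln p - k ln 2), and the last hypothesis makes 2 k ln 2 at most 3 eps ln p. *)
Lemma powR_mul_le (R : realType) (eps : R) (p B G k h : nat) : 0 < eps ->
    (2 ^ h <= p)%N -> (0 < B)%N -> (p <= B * 2 ^ k)%N -> (B ^ 2 <= G)%N ->
    (2 * k)%:R <= eps * 3 * h%:R ->
  (p * G)%:R `^ (2 / 3 - eps) <= G%:R :> R.
Proof.
move=> eps0 hp B0 pB BG hk.
have p0 : (0 < p)%N by apply: leq_trans hp; rewrite expn_gt0.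
have G0 : (0 < G)%N by apply: leq_trans BG; rewrite expn_gt0 B0.
have ln_leq (m n : nat) : (0 < m)%N -> (m <= n)%N -> ln m%:R <= ln n%:R :> R.
  by move=> m0 mn; rewrite ler_ln ?posrE ?ltr0n ?ler_nat // (leq_trans m0).
have L0 : 0 < ln 2 :> R by rewrite ln_gt0 // ltr1n.
have hp' : ln 2 * h%:R <= ln p%:R :> R.
  by rewrite mulr_natr -lnXn // -natrX ln_leq // expn_gt0.
have pB' : ln p%:R <= ln B%:R + ln 2 * k%:R :> R.
  by rewrite mulr_natr -lnXn // -natrX -lnM ?posrE ?ltr0n ?expn_gt0 // -natrM ln_leq.
have BG' : 2 * ln B%:R <= ln G%:R :> R.
  by rewrite mulr_natl -lnXn ?ltr0n // -natrX ln_leq // expn_gt0 B0.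
have p1 : 0 <= ln p%:R :> R by rewrite ln_ge0 // ler1n.
have G1 : 0 <= ln G%:R :> R by rewrite ln_ge0 // ler1n.
rewrite natrM /powR mulf_eq0 !pnatr_eq0 !gtn_eqF //=.
rewrite -[leRHS]lnK ?posrE ?ltr0n // ler_expR lnM ?posrE ?ltr0n //.
rewrite natrM in hk.
have hk' : ln 2 * (2 * k%:R) <= ln 2 * (eps * 3 * h%:R) :> R by rewrite ler_pM2l.
have hp3 : eps * (ln 2 * h%:R) <= eps * ln p%:R :> R by rewrite ler_pM2l.
have Lk0 : 0 <= ln 2 * k%:R :> R by rewrite mulr_ge0 // ltW.
move: (ln p%:R) (ln B%:R) (ln G%:R) (ln 2 : R) (k%:R : R) (h%:R : R)
  p1 G1 BG' pB' hk' hp3 Lk0 => P b g L kk hh P0 g0 bg Pb hk' hp3 Lk0.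
(* For a nonpositive exponent the power is at most 1. *)
have [a0|a0] := lerP (2 / 3 - eps) 0.
  by apply: (@le_trans _ _ 0) => //; rewrite mulr_le0_ge0 // addr_ge0.
suff : (2 / 3 - eps) * P <= (1 / 3 + eps) * g by lra.
have h2 : (1 / 3 + eps) * (2 * (P - L * kk)) <= (1 / 3 + eps) * g.
  by rewrite ler_pM2l; lra.
(* A positive exponent means eps < 2/3, so 1/3 + eps <= 1. *)
have h3 : (1 / 3 + eps) * (L * kk) <= 1 * (L * kk) by rewrite ler_wpM2r //; lra.
by lra.
Qed.

Theorem theorem1p4 (R : realType) (eps : R) (eps_gt0 : 0 < eps) :
  infinite_set [set N : nat | (0 < N)%N /\
    N%:R `^ (2 / 3 - eps) <= (gcdn N (sigma N))%:R :> R].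
Proof.
move=> /finite_seqP[s sE].
pose M := (\sum_(N <- s) N)%N.
(* The three lower bounds on [j] serve to put N beyond the supposed finite set (with j^3 <= 2^j from
   10 on) and to absorb 48 j^2: as 64 <= eps j, 96 j^2 <= (3/2) eps j^3 <= 3 eps 2^(j-1). *)
pose j := maxn (maxn 10 M) (Num.truncn (64 / eps)).+1.
have j10 : (9 < j)%N by rewrite !leq_max.
have Mj : (M <= j)%N by rewrite !leq_max leqnn orbT.
have jeps : 64 <= eps * j%:R.
  rewrite mulrC -ler_pdivrMr //; apply/ltW.
  apply: lt_le_trans (truncnS_gt _) _.
  by rewrite ler_nat leq_maxr.
have [p [B [p_pr hp B0 pB gcdB]]] := exists_large_gcd (leq_trans (isT : (3 < 10)%N) j10).
set N := (p * B * sigma B)%N in gcdB.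
have sB : (B <= sigma B)%N by exact: leq_sigma.
have N0 : (0 < N)%N by rewrite !muln_gt0 prime_gt0 // B0 (leq_trans B0).
have : N \in s.
  suff : [set` s] N by [].
  rewrite -sE; split=> //.
  apply: (@le_trans _ _ (B * sigma B)%:R); last by rewrite ler_nat.
  rewrite /N -mulnA; apply: (powR_mul_le eps_gt0 hp B0 pB).
    by rewrite -mulnn leq_mul2l sB orbT.
  have cube : 2 * (2 ^ j.-1)%:R >= j%:R * j%:R ^+ 2 :> R.
    by rewrite -exprS -natrX -natrM -expnS prednK ?(leq_trans _ j10) // ler_nat leq_cube_exp2.
  have cube' : eps * (j%:R * j%:R ^+ 2) <= eps * (2 * (2 ^ j.-1)%:R) by rewrite ler_pM2l.
  have : 64 * j%:R ^+ 2 <= eps * j%:R * j%:R ^+ 2 by rewrite ler_wpM2r // exprn_ge0.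
  rewrite (_ : (2 * (48 * j ^ 2))%:R = 96 * j%:R ^+ 2 :> R); last first.
    by rewrite mulnA natrM natrX.
  move: cube'; move: ((2 ^ j.-1)%:R : R) (j%:R : R) => Y x; lra.
(* Membership in [s] gives N <= M, whereas M <= j < 2^(2^(j-1)) <= p <= N. *)
move=> /(leq_sum_seq1 id); rewrite -/M leqNgt => /negP; apply.
apply: (leq_ltn_trans Mj); apply: leq_trans (_ : _ <= p)%N _.
  apply: leq_trans hp; rewrite -{1}[j]prednK ?(leq_trans _ j10) //.
  by apply: leq_ltn_trans (ltn_expl _ (ltnSn 1)); exact: ltn_expl.
by rewrite /N -mulnA leq_pmulr // muln_gt0 B0 (leq_trans B0).
Qed.
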